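(* Let $\rho=\frac12(\sigma_{-1}+\sigma_1)$ on $\mathbb{R}^n$, with support $S=\mathbb{S}_{-1}\cup\mathbb{S}_1$. Let $\{S_1,S_2\}$ be a partition of $S$ into two Borel measurable subsets. Then there exist $a\in\mathbb{R}$ and $T_1=\{x\in S: x_1\le a\}$ such that $\mathcal{E}(T_1)\le\mathcal{E}(S_1)$. Moreover, if $S_1$ is minimal for the mean-squared error (that is, $\mathcal{E}(S_1)\le\mathcal{E}(R)$ for every Borel measurable $R\subset S$), then there is a choice of the cutoff $a\in\mathbb{R}$ for which $T_1=\{x\in S: x_1\le a\}$ coincides with $S_1$ or with $S_2$, up to a set of $\rho$-probability zero.
   Context: Here $n$ is a positive integer, $\|\cdot\|$ is the Euclidean norm on $\mathbb{R}^n$, $e_1$ is the first canonical basis vector and $x_1$ is the first coordinate of $x\in\mathbb{R}^n$. For $a\in\mathbb{R}$, $\mathbb{S}_a=\{x\in\mathbb{R}^n:\|x-ae_1\|=1\}$ and $\sigma_a$ is the normalized (total mass one) surface measure on $\mathbb{S}_a$: $\sigma_0$ is the rotation-invariant Borel probability measure on the unit sphere $\mathbb{S}_0$, and $\sigma_a(A+ae_1)=\sigma_0(A)$ for Borel sets $A$. Mean-squared error: for a Borel probability measure $\rho$ on $\mathbb{R}^n$ with support $S$ and a Borel measurable subset $S_1\subset S$ with complement $S_2=S\setminus S_1$, $$\mathcal{E}(S_1)=\min_{c_1\in\mathbb{R}^n}\int_{S_1}\|x-c_1\|^2\,d\rho(x)+\min_{c_2\in\mathbb{R}^n}\int_{S_2}\|x-c_2\|^2\,d\rho(x).$$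 *)

(* Defs.v *)
From HB Require Import structures.
From mathcomp Require Import all_boot all_order all_algebra.
From mathcomp Require Import all_classical all_reals all_analysis.

Set Implicit Arguments.
Unset Strict Implicit.
Unset Printing Implicit Defensive.

Import Order.TTheory GRing.Theory Num.Theory.
Import numFieldNormedType.Exports.

Local Open Scope classical_set_scope.
Local Open Scope ring_scope.

(* The Euclidean space of dimension n.+1 >= 1 is 'rV[R]_n.+1.  Its library norm
   is the sup norm, which induces the usual topology; the Euclidean norm is
   defined below. *)

HB.instance Definition _ (R : realType) (n : nat) :=
  @isMeasurable.Build (sigma_display (@open 'rV[R]_n.+1)) 'rV[R]_n.+1
    <<s @open 'rV[R]_n.+1 >> (@sigma_algebra0 _ setT _) (@sigma_algebraC _ _)
    (@sigma_algebra_bigcup _ setT _).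

Section defs.
Context {R : realType} {n : nat}.
Local Notation V := 'rV[R]_n.+1.

Definition enorm (x : V) : R := Num.sqrt (\sum_i x ord0 i ^+ 2).

Definition e1 : V := delta_mx ord0 ord0.

Definition sphere (a : R) : set V := [set x | enorm (x - a *: e1) = 1].

(* These conditions determine the normalized surface measure s of the unit
   sphere uniquely.  Invariance is under the full orthogonal group: in dimension
   1 the special orthogonal group is trivial and would not determine s. *)
Definition is_sphere_measure (s : probability V R) : Prop :=
  s (sphere 0) = 1%E /\
  forall Q : 'M[R]_n.+1, Q *m Q^T = 1%:M ->
    forall A : set V, measurable A -> s ((fun x => x *m Q) @^-1` A) = s A.

Definition shift_e1 (a : R) (x : V) : V := x + a *: e1.

Lemma measurable_shift_e1 (a : R) : measurable_fun [set: V] (shift_e1 a).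
Proof.
apply: (@measurability _ _ _ _ _ _ (@open V)) => // _ [B oB <-].
rewrite setTI; apply: sub_sigma_algebra.
apply: open_comp => // x _.
have fx : Filter (nbhs x) by exact: nbhs_filter.
exact: (@cvgD _ V V (nbhs x) fx id (cst _) x _ cvg_id (cvg_cst _)).
Qed.

HB.instance Definition _ (a : R) :=
  isMeasurableFun.Build _ _ V V (shift_e1 a) (measurable_shift_e1 a).

(* sigma_a, the image of sigma_0 under the translation by a e_1 *)
Definition sigma (s : probability V R) (a : R) : set V -> \bar R :=
  pushforward s (shift_e1 a).

HB.instance Definition _ (s : probability V R) (a : R) :=
  Measure.copy (sigma s a) (distribution s (shift_e1 a)).

Definition rho (s : probability V R) : set V -> \bar R :=
  mscale (2^-1)%:nng (measure_add (sigma s (-1)) (sigma s 1)).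

HB.instance Definition _ (s : probability V R) := Measure.on (rho s).

Lemma rhoE (s : probability V R) (A : set V) :
  rho s A = ((2^-1)%:E * (sigma s (-1) A + sigma s 1 A))%E.
Proof. by congr (_ * _)%E; exact: measure_addE. Qed.

Lemma rho_setT (s : probability V R) : rho s setT = 1%E.
Proof.
rewrite rhoE /sigma /pushforward !preimage_setT.
rewrite probability_setT -EFinD -EFinM.
by rewrite -[1 + 1]/(2%:R : R) mulVf.
Qed.

HB.instance Definition _ (s : probability V R) :=
  Measure_isProbability.Build _ _ _ (rho s) (rho_setT s).

Definition rho_support : set V := sphere (-1) `|` sphere 1.

(* For finite mu the infimum over the centre c is a minimum: it is attained at
   the mean of mu on A when mu has a second moment on A (at any c if mu A = 0). *)
Definition min_cost (mu : {measure set V -> \bar R}) (A : set V) : \bar R :=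
  ereal_inf (range (fun c : V =>
    \int[mu]_(x in A) (enorm (x - c) ^+ 2)%:E)%E).

Definition mse (mu : {measure set V -> \bar R}) (S S1 : set V) : \bar R :=
  (min_cost mu S1 + min_cost mu (S `\` S1))%E.

Definition left_part (S : set V) (a : R) : set V :=
  [set x | S x /\ x ord0 ord0 <= a].

End defs.

(* Main.v *)
From HB Require Import structures.
Require Import Defs.
From mathcomp Require Import all_boot all_order all_algebra.
From mathcomp Require Import all_classical all_reals all_analysis.
From mathcomp Require Import measurable_realfun ring lra.

Import Order.TTheory GRing.Theory Num.Theory.
Import numFieldNormedType.Exports.

Local Open Scope classical_set_scope.
Local Open Scope ring_scope.

(** Fix a measurable bipartition (A, B) of the support and charge each piece
with the squared distance to its mean, which is its cheapest centre.  Since rho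
has mean zero, the two means lie on a line through the origin, so they can be
written (a + r/2) u and (a - r/2) u with u a unit vector and r >= 0
([means_on_line]).  Write l(x) = <x, u> - a.  The squared distances from x to
these two points are a common term minus, resp. plus, r l(x); hence
[[
  mse A = M + a^2 + r^2/4 - r (int_A l - int_B l)
       >= M + a^2 + r^2/4 - r int |l|,        M = int |x|^2,
]]
with equality, when r > 0, exactly if A and B lie, up to null sets, on the two
sides of the hyperplane l = 0.

By rotation invariance <y, u> has the same law under sigma_0 as y_1, and
averaging |z + t| and |z - t| gives max(|z|, |t|); therefore the integral of
|<x, u> - a| over rho equals the sigma_0-average of max(|y_1 - a|, |u_1|)
([Rintegral_rho_absdot]).  It depends on u only through |u_1| <= 1 and
is nondecreasing in it, so turning u into e_1 while keeping a and r can only lower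
the bound, and for u = e_1 the bound is attained by the half-space cut at a
([left_costE]).  This gives the first claim, with an explicit cutoff.

Let A be minimal.  Comparison with the cut at 0 with centres e_1 and -e_1 gives
mse A <= M - 1, that is, a^2 + r^2/4 + 1 <= r * spread a |u_1|
([minimal_gap]); in particular r > 0.  All inequalities above are equalities.
If |u_1| < 1, then spread a is constant between |u_1| and 1, and convexity in
the second argument makes it equal to the average of |y_1 - a|
([spread_collapse]).  The inequality 2 (r/2) |y_1 - a| <= r^2/4 + (y_1 - a)^2
and the bound 1/2 on the second moment of y_1, valid in dimension at least two,
then contradict the gap ([minimal_direction]).  So u = e_1 or u = - e_1.
Equality in int_A l - int_B l <= int |l| puts A and B on the two sides of the
hyperplane; the remaining question is which piece owns the hyperplane itself,
and it is settled by noting that the half-space cut is a minimiser with the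
same centres, which forces equal masses ([minimal_left]). *)

(** * The Euclidean inner product *)

Section inner_product.
Context {R : realType} {n : nat}.
Local Notation V := 'rV[R]_n.+1.
Implicit Types (x y v : V).

Definition dot x v : R := (x *m v^T) ord0 ord0.

Lemma dotE x v : dot x v = \sum_i x ord0 i * v ord0 i.
Proof. by rewrite /dot mxE; apply: eq_bigr => i _; rewrite mxE. Qed.

Lemma dotC x v : dot x v = dot v x.
Proof. by rewrite !dotE; apply: eq_bigr => i _; rewrite mulrC. Qed.

Lemma dotDl x y v : dot (x + y) v = dot x v + dot y v.
Proof. by rewrite /dot mulmxDl mxE. Qed.

Lemma dotZl a x v : dot (a *: x) v = a * dot x v.
Proof. by rewrite /dot -scalemxAl mxE. Qed.

Lemma dotNl x v : dot (- x) v = - dot x v.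
Proof. by rewrite /dot mulNmx mxE. Qed.

Lemma dotBl x y v : dot (x - y) v = dot x v - dot y v.
Proof. by rewrite dotDl dotNl. Qed.

Lemma dotDr x y v : dot v (x + y) = dot v x + dot v y.
Proof. by rewrite !(dotC v) dotDl. Qed.

Lemma dotZr a x v : dot v (a *: x) = a * dot v x.
Proof. by rewrite !(dotC v) dotZl. Qed.

Lemma dotNr x v : dot v (- x) = - dot v x.
Proof. by rewrite !(dotC v) dotNl. Qed.

Lemma dotBr x y v : dot v (x - y) = dot v x - dot v y.
Proof. by rewrite dotDr dotNr. Qed.

Lemma dot0r v : dot v 0 = 0.
Proof. by rewrite -(scale0r 0) dotZr mul0r. Qed.

Lemma dot_delta x i : dot x (delta_mx ord0 i) = x ord0 i.
Proof.
rewrite dotE (bigD1 i)//= mxE !eqxx mulr1 big1 ?addr0// => j ji.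
by rewrite mxE eqxx (negbTE ji) mulr0.
Qed.

Lemma dot_e1 x : dot x e1 = x ord0 ord0.
Proof. exact: dot_delta. Qed.

Lemma dot_e1e1 : dot (e1 : V) e1 = 1.
Proof. by rewrite dot_e1 mxE. Qed.

Lemma dot_ge0 x : 0 <= dot x x.
Proof. by rewrite dotE sumr_ge0// => i _; rewrite -expr2 sqr_ge0. Qed.

Lemma dot_eq0 x : (dot x x == 0) = (x == 0).
Proof.
apply/idP/eqP => [|->]; last by rewrite dot0r.
rewrite dotE psumr_eq0; last by move=> i _; rewrite -expr2 sqr_ge0.
move=> /allP x0; apply/rowP => i; rewrite mxE.
by have := x0 i (mem_index_enum _); rewrite -expr2 sqrf_eq0 => /eqP.
Qed.

Lemma enormE x : enorm x ^+ 2 = dot x x.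
Proof.
rewrite /enorm sqr_sqrtr; last by rewrite sumr_ge0// => i _; rewrite sqr_ge0.
by rewrite dotE; apply: eq_bigr => i _; rewrite expr2.
Qed.

Lemma sphereP a x : sphere a x <-> dot (x - a *: e1) (x - a *: e1) = 1.
Proof.
rewrite -enormE; split=> [->|/eqP]; first by rewrite expr1n.
rewrite -[X in _ == X](expr1n R 2) eqrXn2 ?sqrtr_ge0// ?ler01//.
by move/eqP.
Qed.

Lemma sphere0P x : sphere 0 x <-> dot x x = 1.
Proof. by rewrite sphereP scale0r subr0. Qed.

Lemma sphere_shift a x : sphere a (shift_e1 a x) <-> sphere 0 x.
Proof. by rewrite sphereP sphere0P /shift_e1 addrK. Qed.

Lemma sqr_dot_unit_le1 u : dot u u = 1 -> (dot u e1) ^+ 2 <= 1.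
Proof.
move=> u1; rewrite -u1 dot_e1 dotE big_ord_recl expr2 lerDl sumr_ge0// => i _.
by rewrite -expr2 sqr_ge0.
Qed.

Lemma norm_dot_unit_le1 u : dot u u = 1 -> `|dot u e1| <= 1.
Proof.
move=> /sqr_dot_unit_le1; rewrite -real_normK ?num_real//.
by rewrite expr_le1.
Qed.

Lemma dot_unit_eq1 u : dot u u = 1 -> dot u e1 = 1 -> u = e1.
Proof.
move=> uu ue; apply/eqP; rewrite -subr_eq0 -dot_eq0.
rewrite dotBl !dotBr dot_e1e1 (dotC e1) uu ue; apply/eqP; ring.
Qed.

Lemma dot_mulmx_orth (Q : 'M[R]_n.+1) x y : Q *m Q^T = 1%:M ->
  dot (x *m Q) (y *m Q) = dot x y.
Proof.
move=> QQ; rewrite /dot trmx_mul mulmxA -(mulmxA x) QQ mulmx1//.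
Qed.

(** The Householder reflection exchanging u and e_1: the reflection along
v = u - e_1 does it because u and e_1 have the same length. *)
Lemma orth_e1_unit u : dot u u = 1 ->
  exists Q : 'M[R]_n.+1, Q *m Q^T = 1%:M /\ forall x, dot (x *m Q) e1 = dot x u.
Proof.
move=> uu; have [->|ue] := eqVneq u e1.
  by exists 1%:M; rewrite trmx1 mulmx1; split=> // x; rewrite mulmx1.
pose v := u - e1; pose s := dot v v.
have s0 : s != 0 by rewrite dot_eq0 subr_eq0.
have sE : s = 2 * (1 - dot u e1).
  rewrite /s /v dotBl !dotBr dot_e1e1 (dotC e1) uu; ring.
have vv x y : x *m v^T *m y = dot x v *: y.
  by rewrite [x *m _]mx11_scalar mul_scalar_mx.
exists (1%:M - (2 / s) *: (v^T *m v)); split; last first.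
  move=> x; rewrite mulmxBr mulmx1 -scalemxAr mulmxA vv scalerA dotBl dotZl.
  have -> : dot v e1 = - (s / 2).
    by rewrite sE /v dotBl dot_e1e1; field.
  rewrite /v dotBr mulrN opprK.
  rewrite [X in _ + X](_ : _ = dot x u - dot x e1); last by field.
  by rewrite addrC subrK.
have -> : (1%:M - (2 / s) *: (v^T *m v))^T = 1%:M - (2 / s) *: (v^T *m v).
  by rewrite raddfB/= tr_scalar_mx linearZ/= trmx_mul trmxK.
rewrite mulmxBr mulmx1 mulmxBl mul1mx.
rewrite -scalemxAr -scalemxAl -!mulmxA (mulmxA v) vv -/s -scalemxAr !scalerA.
rewrite (_ : 2 / s * (2 / s) * s = 2 / s + 2 / s); last by field.
by rewrite scalerDl opprB addrK subrK.
Qed.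

Lemma dotB_sqr x c : dot (x - c) (x - c) = dot x x - 2 * dot x c + dot c c.
Proof. rewrite dotBl !dotBr (dotC c x); ring. Qed.

End inner_product.

(** * Continuity and integrability *)

Section continuous_functions.
Context {R : realType} {n : nat}.
Local Notation V := 'rV[R]_n.+1.
Implicit Types (f g : V -> R).

Lemma cts_cst (c : R) : continuous (fun _ : V => c).
Proof. exact: cst_continuous. Qed.

Lemma cts_add f g : continuous f -> continuous g ->
  continuous (fun x => f x + g x).
Proof.
by move=> cf cg x; apply: (@continuousD R R^o); [exact: cf|exact: cg].
Qed.

Lemma cts_opp f : continuous f -> continuous (fun x => - f x).
Proof. by move=> cf x; apply: (@continuousN R R^o); exact: cf. Qed.

Lemma cts_mul f g : continuous f -> continuous g ->
  continuous (fun x => f x * g x).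
Proof. by move=> cf cg x; apply: continuousM; [exact: cf|exact: cg]. Qed.

Lemma cts_norm f : continuous f -> continuous (fun x => `|f x|).
Proof. 
move=> cf x; apply: (@continuous_comp _ _ _ f Num.norm); first exact: cf.
exact: norm_continuous.
Qed.

Lemma cts_max f g : continuous f -> continuous g ->
  continuous (fun x => Num.max (f x) (g x)).
Proof. by move=> cf cg x; apply: continuous_max; [exact: cf|exact: cg]. Qed.

Lemma cts_coord i : continuous (fun x : V => x ord0 i).
Proof. exact: coord_continuous. Qed.

Lemma cts_sum (I : Type) (r : seq I) (F : I -> V -> R) :
  (forall i, continuous (F i)) -> continuous (fun x => \sum_(i <- r) F i x).
Proof.
move=> cF; elim: r => [|i r IH].
  by under eq_fun do rewrite big_nil; exact: cts_cst.
by under eq_fun do rewrite big_cons; exact: cts_add.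
Qed.

Lemma cts_dot v : continuous (fun x : V => dot x v).
Proof.
under eq_fun do rewrite dotE; apply: cts_sum => i; apply: cts_mul.
  exact: cts_coord.
exact: cts_cst.
Qed.

Lemma cts_dotxx : continuous (fun x : V => dot x x).
Proof.
under eq_fun do rewrite dotE; apply: cts_sum => i.
by apply: cts_mul; exact: cts_coord.
Qed.

Lemma cts_shift f a : continuous f -> continuous (fun x => f (shift_e1 a x)).
Proof.
move=> cf x; apply: (@continuous_comp _ _ _ (shift_e1 a) f); last exact: cf.
exact: (@cvgD _ V V (nbhs x) _ id (cst _) x _ cvg_id (cvg_cst _)).
Qed.

Lemma cts_mulmx (Q : 'M[R]_n.+1) : continuous (fun x : V => x *m Q).
Proof.
rewrite (_ : (fun _ => _) = fun x : V => \sum_i (x ord0 i *: row i Q)).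
  elim: (index_enum _) => [|i r IH].
    by under eq_fun do rewrite big_nil; exact: cst_continuous.
  under eq_fun do rewrite big_cons.
  move=> x; apply: (@continuousD R V _ (fun x : V => x ord0 i *: row i Q));
    last exact: IH.
  by apply: continuousZr_tmp; exact: cts_coord.
by apply/funext => x; rewrite mulmx_sum_row.
Qed.

Lemma continuous_measurable f : continuous f -> measurable_fun setT f.
Proof.
move=> cf; apply: (measurability _ (RGenOpens.measurableE R)).
move=> _ [_ [a [b ->]] <-]; rewrite setTI; apply: sub_sigma_algebra.
by apply: open_comp => //; exact: interval_open.
Qed.

Lemma closed_measurable_rV (A : set V) : closed A -> measurable A.
Proof.
move=> cA; rewrite -[A]setCK; apply: measurableC.
by apply: sub_sigma_algebra; exact: closed_openC.
Qed.

Lemma mx_norm_le (x : V) M :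
  0 <= M -> (forall i, `|x ord0 i| <= M) -> `|x| <= M.
Proof.
move=> M0 xM; rewrite [leLHS]/Num.norm/= mx_normrE.
apply/bigmax_leP; split=> //.
by move=> [i j] _; rewrite (ord1 i).
Qed.

Lemma compact_sphere a : compact (sphere a : set V).
Proof.
apply: bounded_closed_compact; last first.
  pose c : V := a *: e1; pose F (x : V) : R := dot x x - 2 * dot x c + dot c c.
  have cF : continuous F.
    apply: cts_add; last exact: cts_cst.
    apply: cts_add; first exact: cts_dotxx.
    by apply: cts_opp; apply: cts_mul; [exact: cts_cst|exact: cts_dot].
  rewrite (_ : sphere a = F @^-1` [set 1]).
    by have /continuous_closedP := cF; apply; exact: closed_eq.
  by apply/seteqP; split=> x; rewrite sphereP /= dotB_sqr.
exists (1 + `|a *: e1 : V|); split; first exact: num_real.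
move=> M ltM x /sphereP; set y := x - _ => yy.
apply: le_trans (ltW ltM); rewrite -(subrK (a *: e1) x) -/y.
apply: le_trans (ler_normD _ _) _; rewrite lerD2r mx_norm_le// => i.
rewrite -(@expr_le1 _ 2)// real_normK ?num_real// -yy dotE (bigD1 i)//= expr2.
by rewrite lerDl sumr_ge0// => j _; rewrite -expr2 sqr_ge0.
Qed.

Lemma compact_support : compact (rho_support : set V).
Proof. by apply: compactU; exact: compact_sphere. Qed.

Lemma measurable_sphere a : measurable (sphere a : set V).
Proof.
apply: closed_measurable_rV; apply: compact_closed.
  exact: norm_hausdorff.
exact: compact_sphere.
Qed.

Lemma measurable_support : measurable (rho_support : set V).
Proof. by apply: measurableU; exact: measurable_sphere. Qed.

(** Every integrand below is continuous and every domain of integration lies in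
a sphere or in the support, so that integrability never depends on more than
this lemma. *)
Lemma continuous_integrable (mu : {finite_measure set V -> \bar R})
    (K A : set V) f : compact K -> measurable A -> A `<=` K -> continuous f ->
  mu.-integrable A (EFin \o f).
Proof.
move=> cK mA AK cf; apply: measurable_bounded_integrable => //.
- by rewrite -ge0_fin_numE// fin_num_measure.
- by apply: measurable_funTS; exact: continuous_measurable.
- have [M [Mr Mb]] : bounded_set (f @` K : set R^o).
    apply: compact_bounded; apply: continuous_compact => //.
    by apply: continuous_subspaceT.
  exists M; split=> // N MN x /AK Kx.
  by apply: (Mb _ MN); exists x.
Qed.

End continuous_functions.

(** * Integration against rho *)

Section transfer.
Context {R : realType} {n : nat}.
Local Notation V := 'rV[R]_n.+1.
Variable s : probability V R.
Implicit Types (f g : V -> R) (A : set V).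
Local Notation S := (rho_support : set V).
Local Notation S0 := (sphere 0 : set V).

Lemma integrable_rho A f : measurable A -> A `<=` S -> continuous f ->
  (rho s).-integrable A (EFin \o f).
Proof.
move=> mA AS cf.
exact: (@continuous_integrable _ _ (rho s) _ _ _ compact_support mA AS cf).
Qed.

Lemma integrable_sphere f : continuous f -> s.-integrable S0 (EFin \o f).
Proof.
move=> cf; apply: (@continuous_integrable _ _ s S0 S0 f) => //.
- exact: compact_sphere.
- exact: measurable_sphere.
Qed.

Hypothesis sP : is_sphere_measure s.

Lemma sphere_setC0 : s (~` S0) = 0%E.
Proof.
have [s1 _] := sP; rewrite probability_setC ?s1 ?subee//.
exact: measurable_sphere.
Qed.

Lemma ge0_integral_sigma a f : continuous f -> (forall x, 0 <= f x) ->
  sphere a `<=` S ->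
  (\int[sigma s a]_(x in S) (f x)%:E =
   \int[s]_(y in S0) (f (shift_e1 a y))%:E)%E.
Proof.
move=> cf f0 aS.
have mf : measurable_fun [set: V] (EFin \o f).
  by apply/measurable_EFinP; exact: continuous_measurable.
rewrite ge0_integral_pushforward//; first last.
- by move=> x _; rewrite lee_fin.
- exact: measurable_funTS.
- exact: measurable_support.
rewrite (@ge0_negligible_integral _ _ _ _ _ (~` S0))//; first last.
- exact: sphere_setC0.
- by move=> x _; rewrite lee_fin.
- apply: measurable_funTS; apply: measurableT_comp => //.
- rewrite -[X in measurable X]setTI; apply: measurable_shift_e1 => //.
  exact: measurable_support.
- by apply: measurableC; exact: measurable_sphere.
congr integral; rewrite setDE setCK; apply/seteqP; split=> [x []//|x x0].
by split=> //; apply: aS; apply/sphere_shift.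
Qed.

Lemma ge0_Rintegral_rho f : continuous f -> (forall x, 0 <= f x) ->
  \int[rho s]_(x in S) f x =
  2^-1 * (\int[s]_(y in S0) f (shift_e1 1 y) +
          \int[s]_(y in S0) f (shift_e1 (-1) y)).
Proof.
move=> cf f0.
have mf : measurable_fun S (EFin \o f).
  by apply/measurable_EFinP/measurable_funTS; exact: continuous_measurable.
have fin a : (\int[s]_(y in S0) (f (shift_e1 a y))%:E)%E \is a fin_num.
  apply: (@integrable_fin_num _ _ _ s); first exact: measurable_sphere.
  by apply: integrable_sphere; exact: cts_shift.
rewrite /Rintegral /rho ge0_integral_mscale//=; first last.
- by move=> x _; rewrite lee_fin.
- exact: measurable_support.
rewrite ge0_integral_measure_add//; first last.
- by move=> x _; rewrite lee_fin.
- exact: measurable_support.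
rewrite !ge0_integral_sigma//.
- rewrite fineM//; last by rewrite fin_numD !fin.
  by rewrite fineD ?fin// addrC.
- by move=> x ?; right.
- by move=> x ?; left.
Qed.

(** Reduces every integral against rho over its support to averages over the
unit sphere.  The preimage of the support under a translation is larger than
the unit sphere, but only by a null set. *)
Lemma Rintegral_rho f : continuous f ->
  \int[rho s]_(x in S) f x =
  2^-1 * (\int[s]_(y in S0) f (shift_e1 1 y) +
          \int[s]_(y in S0) f (shift_e1 (-1) y)).
Proof.
(* the nonnegative case, applied to the positive and negative parts *)
move=> cf; pose g x := Num.max (f x) 0; pose h x := Num.max (- f x) 0.
have cg : continuous g by apply: cts_max => //; exact: cts_cst.
have ch : continuous h.
  by apply: cts_max; [exact: cts_opp|exact: cts_cst].
have fE x : f x = g x - h x.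
  by rewrite /g /h; case: (leP 0 (f x)) => ?; case: leP => ?; lra.
have g0 x : 0 <= g x by rewrite /g le_max lexx orbT.
have h0 x : 0 <= h x by rewrite /h le_max lexx orbT.
have gE a : \int[s]_(y in S0) f (shift_e1 a y) =
    \int[s]_(y in S0) g (shift_e1 a y) - \int[s]_(y in S0) h (shift_e1 a y).
  rewrite -RintegralB; first by apply: eq_Rintegral => y _; rewrite fE.
  - exact: measurable_sphere.
  - by apply: integrable_sphere; exact: cts_shift.
  - by apply: integrable_sphere; exact: cts_shift.
rewrite !gE.
have -> : \int[rho s]_(x in S) f x = \int[rho s]_(x in S) (g x - h x).
  by apply: eq_Rintegral => x _; rewrite fE.
rewrite RintegralB; first last.
- by apply: integrable_rho => //; exact: measurable_support.
- by apply: integrable_rho => //; exact: measurable_support.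
- exact: measurable_support.
by rewrite (ge0_Rintegral_rho _ cg g0) (ge0_Rintegral_rho _ ch h0); ring.
Qed.

Lemma Rintegral_rotate (Q : 'M[R]_n.+1) f : Q *m Q^T = 1%:M -> continuous f ->
  \int[s]_(y in S0) f (y *m Q) = \int[s]_(y in S0) f y.
Proof.
move=> QQ cf; have [_ sQ] := sP.
have mQ : measurable_fun setT (fun x : V => x *m Q).
  apply: (@measurability _ _ _ _ _ _ (@open V)) => // _ [B oB <-].
  rewrite setTI; apply: sub_sigma_algebra.
  apply: open_comp => // x _.
  exact: cts_mulmx.
have mf : measurable_fun [set: V] (EFin \o f).
  by apply/measurable_EFinP; exact: continuous_measurable.
have QS0 : (fun x : V => x *m Q) @^-1` S0 = S0.
  by apply/seteqP; split => x /=; rewrite !sphere0P dot_mulmx_orth.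
have cfQ : continuous (fun x : V => f (x *m Q)).
  move=> x; have H := @continuous_comp V V R (fun x : V => x *m Q : V) f x.
  apply: H; last exact: cf.
  exact: cts_mulmx.
have iQ : s.-integrable ((fun x : V => x *m Q) @^-1` S0)
    ((EFin \o f) \o (fun x : V => x *m Q)).
  rewrite QS0; exact: (integrable_sphere _ cfQ).
have := integral_pushforward mQ mf iQ (measurable_sphere 0).
rewrite QS0 /Rintegral => /= <-; congr fine.
by apply: eq_measure_integral => A mA _; exact: sQ.
Qed.

End transfer.

(** * Averages over the unit sphere *)

Lemma normD_normB (K : realFieldType) (z t : K) :
  2^-1 * (`|z + t| + `|z - t|) = Num.max `|z| `|t|.
Proof.
have [t0|t0] := leP 0 t; rewrite ?(ger0_norm t0) ?(ltr0_norm t0);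
have [z0|z0] := leP 0 z; rewrite ?(ger0_norm z0) ?(ltr0_norm z0);
have [p|p] := leP 0 (z + t); rewrite ?(ger0_norm p) ?(ltr0_norm p);
have [m|m] := leP 0 (z - t); rewrite ?(ger0_norm m) ?(ltr0_norm m);
by case: leP => ?; lra.
Qed.

Section sphere_averages.
Context {R : realType} {n : nat}.
Local Notation V := 'rV[R]_n.+1.
Variable s : probability V R.
Hypothesis sP : is_sphere_measure s.
Implicit Types (f g : V -> R) (A : set V).
Local Notation S := (rho_support : set V).
Local Notation S0 := (sphere 0 : set V).
Local Notation "''L' f" := (\int[s]_(y in S0) f y) (at level 10, f at level 8).

Lemma le_Rintegral_sphere f g : continuous f -> continuous g ->
  (forall y, dot y y = 1 -> f y <= g y) -> 'L f <= 'L g.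
Proof.
move=> cf cg fg; apply: le_Rintegral.
- exact: measurable_sphere.
- exact: integrable_sphere.
- exact: integrable_sphere.
- by move=> y /sphere0P; exact: fg.
Qed.

Lemma RintegralD_sphere f g : continuous f -> continuous g ->
  'L (fun y => f y + g y) = 'L f + 'L g.
Proof.
move=> cf cg; apply: RintegralD.
- exact: measurable_sphere.
- exact: integrable_sphere.
- exact: integrable_sphere.
Qed.

Lemma RintegralZ_sphere c f : continuous f ->
  'L (fun y => c * f y) = c * 'L f.
Proof.
move=> cf; apply: RintegralZl; first exact: measurable_sphere.
exact: integrable_sphere.
Qed.

Lemma Rintegral_sphere_cst c : 'L (fun _ => c) = c.
Proof.
have s1 : fine (s S0) = 1 by rewrite (proj1 sP).
rewrite Rintegral_cst; last exact: measurable_sphere.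
by rewrite [X in c * X](_ : _ = 1) ?mulr1//; exact: s1.
Qed.

Lemma Rintegral_sphere_dot u (g : R -> R) :
  dot u u = 1 -> continuous (fun y : V => g (dot y e1)) ->
  'L (fun y => g (dot y u)) = 'L (fun y => g (dot y e1)).
Proof.
move=> uu cg; have [Q [QQ Qu]] := orth_e1_unit _ uu.
rewrite -(Rintegral_rotate _ sP _ _ QQ cg).
by apply: eq_Rintegral => y _; rewrite Qu.
Qed.

(** Invariance under the antipodal map. *)
Lemma Rintegral_sphere_dot0 v : 'L (fun y => dot y v) = 0.
Proof.
have QQ : (- 1%:M : 'M[R]_n.+1) *m (- 1%:M)^T = 1%:M.
  by rewrite raddfN /= tr_scalar_mx mulmxN mulNmx opprK mulmx1.
have H := Rintegral_rotate _ sP _ _ QQ (cts_dot v).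
suff : 'L (fun y => dot y v) = - 'L (fun y => dot y v) by lra.
rewrite -[in LHS]H -[RHS]mulN1r -RintegralZ_sphere; last exact: cts_dot.
by apply: eq_Rintegral => y _; rewrite mulmxN mulmx1 dotNl mulN1r.
Qed.

(** Two coordinates have equal second moments by symmetry, and their squares
add up to at most 1. *)
Lemma Rintegral_sphere_sqr : (0 < n)%N ->
  'L (fun y => dot y e1 ^+ 2) <= 2^-1.
Proof.
move=> n0; pose u : V := delta_mx ord0 ord_max.
have m0 : (ord_max : 'I_n.+1) != ord0 by rewrite -val_eqE /= -lt0n.
have uu : dot u u = 1 by rewrite dot_delta mxE !eqxx.
have csq (v : V) : continuous (fun y : V => dot y v ^+ 2).
  by under eq_fun do rewrite expr2; apply: cts_mul; exact: cts_dot.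
have := Rintegral_sphere_dot u (fun t => t ^+ 2) uu (csq e1).
have : 'L (fun y => dot y u ^+ 2 + dot y e1 ^+ 2) <= 'L (fun _ => 1).
  apply: le_Rintegral_sphere; [exact: cts_add|exact: cts_cst|move=> y <-].
  rewrite dot_e1 dot_delta dotE (bigD1 ord0)//= (bigD1 ord_max)//=.
  rewrite -!expr2 addrCA addrA lerDl sumr_ge0// => i _.
  by rewrite -expr2 sqr_ge0.
rewrite Rintegral_sphere_cst RintegralD_sphere//; lra.
Qed.

(** The integral against rho of |<x, u> - a| over the support, when u is a unit
vector with |u_1| = t; see [Rintegral_rho_absdot]. *)
Definition spread (a t : R) : R :=
  'L (fun y => Num.max `|dot y e1 - a| t).

Lemma cts_absdot u a : continuous (fun y : V => `|dot y u - a|).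
Proof. by apply: cts_norm; apply: cts_add; [exact: cts_dot|exact: cts_cst]. Qed.

Lemma cts_spread u a t : continuous (fun y : V => Num.max `|dot y u - a| t).
Proof. by apply: cts_max; [exact: cts_absdot|exact: cts_cst]. Qed.

Lemma Rintegral_rho_dot v : \int[rho s]_(x in S) dot x v = 0.
Proof.
rewrite (Rintegral_rho _ sP _ (cts_dot v)).
have E b : 'L (fun y => dot (shift_e1 b y) v) = b * dot e1 v.
  transitivity ('L (fun y => dot y v + b * dot e1 v)).
    by apply: eq_Rintegral => y _; rewrite /shift_e1 dotDl dotZl.
  rewrite RintegralD_sphere; [|exact: cts_dot|exact: cts_cst].
  by rewrite Rintegral_sphere_dot0 Rintegral_sphere_cst add0r.
by rewrite !E; ring.
Qed.

(** The two spheres shift <y, u> by u_1 and by - u_1, and <y, u> is distributed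
like y_1; [normD_normB] merges the two shifts. *)
Lemma Rintegral_rho_absdot u a : dot u u = 1 ->
  \int[rho s]_(x in S) `|dot x u - a| = spread a `|dot u e1|.
Proof.
move=> uu; pose t := dot u e1.
have cg b (v : V) : continuous (fun y : V => `|dot y v + b - a|).
  apply: cts_norm; apply: cts_add; last exact: cts_cst.
  by apply: cts_add; [exact: cts_dot|exact: cts_cst].
rewrite (Rintegral_rho _ sP); last exact: cts_absdot.
have E b : 'L (fun y => `|dot (shift_e1 b y) u - a|)
           = 'L (fun y => `|dot y e1 + b * t - a|).
  rewrite -(Rintegral_sphere_dot u (fun r => `|r + b * t - a|) uu (cg _ _)).
  by apply: eq_Rintegral => y _; rewrite /shift_e1 dotDl dotZl (dotC e1).
rewrite !E -RintegralD_sphere// -RintegralZ_sphere; last exact: cts_add.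
apply: eq_Rintegral => y _; rewrite mul1r mulN1r -/t.
rewrite -normD_normB; set z := dot y e1.
by congr (_ * (_ + _)); congr (`|_|); ring.
Qed.

Lemma le_spread a t t' : t <= t' -> spread a t <= spread a t'.
Proof.
move=> tt'; apply: le_Rintegral_sphere; [exact: cts_spread..|move=> y _].
by rewrite ge_max !le_max lexx tt' orbT.
Qed.

Lemma spread_ge a t : t <= spread a t.
Proof.
rewrite -[leLHS]Rintegral_sphere_cst; apply: le_Rintegral_sphere.
- exact: cts_cst.
- exact: cts_spread.
- by move=> y _; rewrite le_max lexx orbT.
Qed.

(** For z >= 0 the function max(z, t) is convex in t, with value z at t = 0; so
if [spread a] takes the same value at some t < 1 and at 1, this value is at most
the one at 0. *)
Lemma spread_collapse a t : 0 <= t < 1 -> spread a 1 <= spread a t ->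
  spread a 1 <= 'L (fun y => `|dot y e1 - a|).
Proof.
move=> /andP[t0 t1] st.
have c1 : continuous (fun y : V => t * Num.max `|dot y e1 - a| 1).
  by apply: cts_mul; [exact: cts_cst|exact: cts_spread].
have c2 : continuous (fun y : V => (1 - t) * `|dot y e1 - a|).
  by apply: cts_mul; [exact: cts_cst|exact: cts_absdot].
have : spread a t <= t * spread a 1 + (1 - t) * 'L (fun y => `|dot y e1 - a|).
  rewrite -!RintegralZ_sphere; [|exact: cts_absdot|exact: cts_spread].
  rewrite -RintegralD_sphere//; apply: le_Rintegral_sphere => [||y _].
  - exact: cts_spread.
  - exact: cts_add.
  - have z0 := normr_ge0 (dot y e1 - a).
    by case: (leP `|dot y e1 - a| t); case: (leP `|dot y e1 - a| 1); nra.
nra.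
Qed.

Lemma absdot_le_quadratic a r : 0 <= r -> (0 < n)%N ->
  r * 'L (fun y => `|dot y e1 - a|) <= r ^+ 2 / 4 + a ^+ 2 + 2^-1.
Proof.
move=> r0 n0; have sq := Rintegral_sphere_sqr n0.
have csq : continuous (fun y : V => dot y e1 ^+ 2).
  by under eq_fun do rewrite expr2; apply: cts_mul; exact: cts_dot.
rewrite -RintegralZ_sphere; last exact: cts_absdot.
have le : 'L (fun y => r * `|dot y e1 - a|) <=
   'L (fun y => dot y e1 ^+ 2 + (- (2 * a) * dot y e1 + (r ^+ 2 / 4 + a ^+ 2))).
  apply: le_Rintegral_sphere => [||y _].
  - by apply: cts_mul; [exact: cts_cst|exact: cts_absdot].
  - apply: cts_add => //; apply: cts_add; last exact: cts_cst.
    by apply: cts_mul; [exact: cts_cst|exact: cts_dot].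
  - have := sqr_ge0 (`|dot y e1 - a| - r / 2).
    have := real_normK (num_real (dot y e1 - a)); nra.
apply: le_trans le _; rewrite RintegralD_sphere//; last first.
  apply: cts_add; last exact: cts_cst.
  by apply: cts_mul; [exact: cts_cst|exact: cts_dot].
rewrite RintegralD_sphere; last exact: cts_cst; last first.
  by apply: cts_mul; [exact: cts_cst|exact: cts_dot].
rewrite RintegralZ_sphere; last exact: cts_dot.
rewrite Rintegral_sphere_dot0 Rintegral_sphere_cst; lra.
Qed.

End sphere_averages.

(** * Costs, masses and means *)

Section costs.
Context {R : realType} {n : nat}.
Local Notation V := 'rV[R]_n.+1.
Variable s : probability V R.
Hypothesis sP : is_sphere_measure s.
Implicit Types (f g : V -> R) (A B : set V) (c u v : V) (a r : R).
Local Notation S := (rho_support : set V).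
Local Notation P A f := (\int[rho s]_(x in A) f x).

Definition mass A : R := fine (rho s A).

Lemma rhoE_mass A : measurable A -> rho s A = (mass A)%:E.
Proof. by move=> mA; rewrite fineK// fin_num_measure. Qed.

Lemma mass_ge0 A : 0 <= mass A.
Proof. by rewrite fine_ge0. Qed.

Lemma massU A B : measurable A -> measurable B -> A `&` B = set0 ->
  mass (A `|` B) = mass A + mass B.
Proof.
move=> mA mB AB; rewrite /mass measureU// fineD//; exact: fin_num_measure.
Qed.

Lemma RintegralD_rho A f g : measurable A -> A `<=` S ->
  continuous f -> continuous g -> P A (fun x => f x + g x) = P A f + P A g.
Proof.
by move=> mA AS cf cg; apply: RintegralD => //; exact: integrable_rho.
Qed.

Lemma RintegralZ_rho A k f : measurable A -> A `<=` S ->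
  continuous f -> P A (fun x => k * f x) = k * P A f.
Proof. by move=> mA AS cf; apply: RintegralZl => //; exact: integrable_rho. Qed.

Lemma Rintegral_rho_cst A k : measurable A -> P A (fun _ => k) = k * mass A.
Proof. by move=> mA; rewrite Rintegral_cst. Qed.

Lemma RintegralU_rho A B f : measurable A -> measurable B -> A `|` B = S ->
  A `&` B = set0 -> continuous f -> P A f + P B f = P S f.
Proof.
move=> mA mB ABS AB cf; rewrite -ABS Rintegral_setU//.
- by apply: integrable_rho; [exact: measurableU|rewrite ABS|].
- by rewrite disj_set2E AB.
Qed.

Lemma le_Rintegral_rho A f g : measurable A -> A `<=` S ->
  continuous f -> continuous g -> (forall x, f x <= g x) -> P A f <= P A g.
Proof.
by move=> mA AS cf cg fg; apply: le_Rintegral => //; exact: integrable_rho.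
Qed.

Lemma Rintegral_rho_null A f : measurable A -> mass A = 0 -> continuous f ->
  P A f = 0.
Proof.
move=> mA A0 cf; rewrite /Rintegral null_set_integral//.
- by apply/measurable_EFinP/measurable_funTS; exact: continuous_measurable.
- by have := rhoE_mass _ mA; rewrite A0.
Qed.

Lemma mass_pos_integral0 A f : measurable A -> A `<=` S -> continuous f ->
  (forall x, 0 <= f x) -> P A f = 0 -> mass (A `&` [set x | 0 < f x]) = 0.
Proof.
move=> mA AS cf f0 Pf.
have mf : measurable_fun A (EFin \o f).
  by apply/measurable_EFinP/measurable_funTS; exact: continuous_measurable.
have : (\int[rho s]_(x in A) `|(EFin \o f) x| = 0)%E.
  under eq_integral do rewrite /= ger0_norm//.
  rewrite -[LHS]fineK; first by rewrite -[fine _]/(P A f) Pf.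
  by apply: (@integrable_fin_num _ _ _ (rho s)) => //; exact: integrable_rho.
move/(ae_eq_integral_abs _ mA mf) => [N [mN N0 sN]].
rewrite /mass (@subset_measure0 _ _ _ (rho s) _ N)//.
- apply: measurableI => //; rewrite -[X in measurable X]setTI.
  rewrite (_ : [set x | 0 < f x] = f @^-1` `]0, +oo[%classic); last first.
    by apply/seteqP; split => x /=; rewrite in_itv/= andbT.
  exact: continuous_measurable.
- move=> x [Ax fx]; apply: sN => /= /(_ Ax) [fx0].
  by move: fx; rewrite /= fx0 ltxx.
Qed.

Definition cost A c : R := P A (fun x => dot (x - c) (x - c)).

(** Stated without dividing by the mass, so that every point is a mean of a null
set. *)
Definition is_mean A c := forall v, P A (fun x => dot x v) = mass A * dot c v.

Lemma Rintegral_rho_sum A (I : Type) (l : seq I) (F : I -> V -> R) :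
  measurable A -> A `<=` S -> (forall i, continuous (F i)) ->
  P A (fun x => \sum_(i <- l) F i x) = \sum_(i <- l) P A (F i).
Proof.
move=> mA AS cF; elim: l => [|i l IH].
  by under eq_fun do rewrite big_nil; rewrite Rintegral_rho_cst// mul0r big_nil.
under eq_fun do rewrite big_cons.
rewrite RintegralD_rho//; first by rewrite IH big_cons.
exact: cts_sum.
Qed.

Lemma exists_mean A : measurable A -> A `<=` S -> exists c, is_mean A c.
Proof.
move=> mA AS; have [A0|A0] := eqVneq (mass A) 0.
  exists 0 => v; rewrite A0 mul0r Rintegral_rho_null//; exact: cts_dot.
exists (\row_i ((mass A)^-1 * P A (fun x => x ord0 i))) => v.
under eq_fun do rewrite dotE.
rewrite Rintegral_rho_sum//; last first.
  by move=> i; apply: cts_mul; [exact: cts_coord|exact: cts_cst].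
rewrite dotE mulr_sumr; apply: eq_bigr => i _; rewrite mxE.
rewrite !mulrA divff// mul1r mulrC -RintegralZ_rho//; last exact: cts_coord.
by under eq_fun do rewrite mulrC.
Qed.

Lemma cts_cost c : continuous (fun x : V => dot (x - c) (x - c)).
Proof.
under eq_fun do rewrite dotB_sqr.
apply: cts_add; last exact: cts_cst.
apply: cts_add; first exact: cts_dotxx.
by apply: cts_opp; apply: cts_mul; [exact: cts_cst|exact: cts_dot].
Qed.

Lemma cost_expand A c : measurable A -> A `<=` S ->
  cost A c = P A (fun x => dot x x) - 2 * P A (fun x => dot x c)
             + dot c c * mass A.
Proof.
move=> mA AS; rewrite /cost; under eq_fun do rewrite dotB_sqr -mulNr.
have c2 : continuous (fun x => - 2 * dot x c).
  by apply: cts_mul; [exact: cts_cst|exact: cts_dot].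
rewrite RintegralD_rho//; last exact: cts_cst; last first.
  by apply: cts_add => //; exact: cts_dotxx.
rewrite RintegralD_rho//; last exact: cts_dotxx.
by rewrite RintegralZ_rho//; [rewrite mulNr Rintegral_rho_cst|exact: cts_dot].
Qed.

(** The parallel axis theorem; it makes a mean the cheapest centre. *)
Lemma cost_mean A m c : measurable A -> A `<=` S -> is_mean A m ->
  cost A c = cost A m + mass A * dot (c - m) (c - m).
Proof.
move=> mA AS Am; rewrite !cost_expand// dotB_sqr !Am (dotC m c); ring.
Qed.

Lemma cost_integral A c : measurable A -> A `<=` S ->
  (\int[rho s]_(x in A) (enorm (x - c) ^+ 2)%:E = (cost A c)%:E)%E.
Proof.
move=> mA AS; under eq_integral do rewrite enormE.
rewrite /cost /Rintegral fineK//.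
apply: (@integrable_fin_num _ _ _ (rho s)) => //.
by apply: integrable_rho => //; exact: cts_cost.
Qed.

Lemma min_cost_le A c : measurable A -> A `<=` S ->
  (min_cost (rho s) A <= (cost A c)%:E)%E.
Proof.
by move=> mA AS; rewrite -cost_integral//; apply: ereal_inf_lbound; exists c.
Qed.

Lemma min_cost_mean A m : measurable A -> A `<=` S -> is_mean A m ->
  min_cost (rho s) A = (cost A m)%:E.
Proof.
move=> mA AS Am; apply/eqP; rewrite eq_le min_cost_le//=.
apply: le_ereal_inf_tmp => _ [c _ <-]; rewrite cost_integral// lee_fin.
by rewrite (cost_mean A m c mA AS Am) lerDl mulr_ge0 ?mass_ge0 ?dot_ge0.
Qed.

End costs.

(** * Bipartitions with collinear centres *)

Section two_means.
Context {R : realType} {n : nat}.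
Local Notation V := 'rV[R]_n.+1.
Variable s : probability V R.
Hypothesis sP : is_sphere_measure s.
Implicit Types (A B : set V) (c u v : V) (a r : R).
Local Notation S := (rho_support : set V).
Local Notation P A f := (\int[rho s]_(x in A) f x).
Local Notation M := (P S (fun x => dot x x)).

Record bipartition A B : Prop := Bipartition {
  bip_measl : measurable A; bip_measr : measurable B;
  bip_union : A `|` B = S; bip_disj : A `&` B = set0 }.

Lemma bipartitionC A B : bipartition A B -> bipartition B A.
Proof. by case=> mA mB U I; split => //; [rewrite setUC|rewrite setIC]. Qed.

Lemma bip_subl A B : bipartition A B -> A `<=` S.
Proof. by case=> _ _ <- _ x; left. Qed.

Lemma bip_subr A B : bipartition A B -> B `<=` S.
Proof. by case=> _ _ <- _ x; right. Qed.

Lemma bip_setD A B : bipartition A B -> S `\` A = B.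
Proof.
case=> _ _ <- AB; apply/seteqP; split=> x; first by move=> [[]].
by move=> Bx; split; [right|move=> Ax; rewrite -[False]/(set0 x) -AB].
Qed.

Lemma bip_mass A B : bipartition A B -> mass s A + mass s B = 1.
Proof.
case=> mA mB U I; rewrite -massU// U.
have := Rintegral_rho s sP (fun _ => 1) (cts_cst 1).
rewrite Rintegral_rho_cst ?mul1r; last exact: measurable_support.
by move=> ->; rewrite !(Rintegral_sphere_cst s sP 1); field.
Qed.

Lemma bip_Rintegral A B f : bipartition A B -> continuous f ->
  P A f + P B f = P S f.
Proof. by case=> mA mB U I cf; apply: RintegralU_rho. Qed.

Lemma cts_lin u a : continuous (fun x : V => dot x u - a).
Proof. by apply: cts_add; [exact: cts_dot|exact: cts_cst]. Qed.

Lemma Rintegral_lin A u a : measurable A -> A `<=` S ->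
  P A (fun x => dot x u - a) = P A (fun x => dot x u) - a * mass s A.
Proof.
move=> mA AS; rewrite RintegralD_rho//; [|exact: cts_dot|exact: cts_cst].
by rewrite Rintegral_rho_cst// mulNr.
Qed.

(** The squared distances to (a + r/2) u and (a - r/2) u differ from their
common part by - r (<x, u> - a) and + r (<x, u> - a); the cross term
2 a <x, u> integrates to zero. *)
Lemma cost_sum A B u a r : bipartition A B -> dot u u = 1 ->
  cost s A ((a + r / 2) *: u) + cost s B ((a - r / 2) *: u) =
  M + a ^+ 2 + r ^+ 2 / 4
  - r * (P A (fun x => dot x u - a) - P B (fun x => dot x u - a)).
Proof.
move=> AB uu; have [mA mB _ _] := AB.
have AS := bip_subl _ _ AB; have BS := bip_subr _ _ AB.
rewrite !cost_expand// !dotZl !dotZr uu !Rintegral_lin//.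
have E D k : measurable D -> D `<=` S ->
    P D (fun x => dot x (k *: u)) = k * P D (fun x => dot x u).
  move=> mD DS; rewrite -RintegralZ_rho//; last exact: cts_dot.
  by apply: eq_Rintegral => x _; rewrite dotZr.
rewrite !E//.
have mAE : mass s A = 1 - mass s B by rewrite -(bip_mass _ _ AB) addrK.
have := bip_Rintegral _ _ _ AB (cts_dot u).
rewrite (Rintegral_rho_dot _ sP) => /eqP; rewrite addr_eq0 => /eqP ->.
by rewrite -(bip_Rintegral _ _ _ AB cts_dotxx) mAE; field.
Qed.

Lemma bip_excess_le A B u a : bipartition A B ->
  P A (fun x => dot x u - a) - P B (fun x => dot x u - a) <=
  P S (fun x => `|dot x u - a|).
Proof.
move=> AB; have [mA mB _ _] := AB.
have AS := bip_subl _ _ AB; have BS := bip_subr _ _ AB.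
rewrite -(bip_Rintegral _ _ _ AB (cts_absdot u a)) lerD//.
  apply: le_Rintegral_rho => //; [exact: cts_lin|exact: cts_absdot|].
  by move=> x; exact: ler_norm.
rewrite -mulN1r -RintegralZ_rho//; last exact: cts_lin.
apply: le_Rintegral_rho => //; last 1 first.
- by move=> x; rewrite mulN1r -normrN ler_norm.
- by apply: cts_mul; [exact: cts_cst|exact: cts_lin].
- exact: cts_absdot.
Qed.

Lemma measurable_left a : measurable (left_part S a).
Proof.
rewrite (_ : left_part S a = S `&` (fun x => dot x e1) @^-1` `]-oo, a]%classic).
  apply: measurableI; first exact: measurable_support.
  rewrite -[X in measurable X]setTI; apply: continuous_measurable => //.
  exact: cts_dot.
by apply/seteqP; split=> x [Sx]; rewrite /= in_itv/= dot_e1.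
Qed.

Lemma left_bip a : bipartition (S `\` left_part S a) (left_part S a).
Proof.
split.
- by apply: measurableD; [exact: measurable_support|exact: measurable_left].
- exact: measurable_left.
- by rewrite setUC; apply: setDUK => x [].
- by rewrite setIC setDIK.
Qed.

Lemma left_abs a :
  P (S `\` left_part S a) (fun x => dot x e1 - a) =
    P (S `\` left_part S a) (fun x => `|dot x e1 - a|) /\
  P (left_part S a) (fun x => dot x e1 - a) =
    - P (left_part S a) (fun x => `|dot x e1 - a|).
Proof.
split.
  apply: eq_Rintegral => x /set_mem [Sx] /not_andP []// /negP.
  by rewrite -ltNge dot_e1 => xa; rewrite gtr0_norm// subr_gt0.
have LB := left_bip a.
rewrite -[RHS]mulN1r -RintegralZ_rho//; last exact: cts_absdot.
- apply: eq_Rintegral => x /set_mem [_]; rewrite dot_e1 => xa.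
  by rewrite ler0_norm ?mulN1r ?opprK// subr_le0.
- exact: measurable_left.
- exact: bip_subr LB.
Qed.

(** The value of [cost_sum] for the direction e_1 when the pieces are the two
sides of the hyperplane x_1 = a. *)
Definition left_cost a r := M + a ^+ 2 + r ^+ 2 / 4 - r * spread s a 1.

Lemma left_costE a r :
  cost s (S `\` left_part S a) ((a + r / 2) *: e1) +
  cost s (left_part S a) ((a - r / 2) *: e1) = left_cost a r.
Proof.
rewrite (cost_sum _ _ _ _ _ (left_bip a) dot_e1e1).
have [-> ->] := left_abs a.
rewrite opprK (bip_Rintegral _ _ _ (left_bip a) (cts_absdot e1 a)).
by rewrite (Rintegral_rho_absdot _ sP _ _ dot_e1e1) dot_e1e1 normr1.
Qed.

Lemma mse_means A B cA cB : bipartition A B -> is_mean s A cA ->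
  is_mean s B cB -> mse (rho s) S A = (cost s A cA + cost s B cB)%:E.
Proof.
move=> AB mcA mcB; have [mA mB _ _] := AB.
rewrite /mse (bip_setD _ _ AB) (min_cost_mean _ _ cA)//;
  last exact: bip_subl AB.
by rewrite (min_cost_mean _ _ cB)//; exact: bip_subr AB.
Qed.

Lemma mse_le A B cA cB : bipartition A B ->
  (mse (rho s) S A <= (cost s A cA + cost s B cB)%:E)%E.
Proof.
move=> AB; have [mA mB _ _] := AB.
rewrite /mse (bip_setD _ _ AB) EFinD leeD// min_cost_le//.
  exact: bip_subl AB.
exact: bip_subr AB.
Qed.

Lemma mseC A B : bipartition A B -> mse (rho s) S A = mse (rho s) S B.
Proof.
move=> AB; rewrite /mse (bip_setD _ _ AB) (bip_setD _ _ (bipartitionC _ _ AB)).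
by rewrite addeC.
Qed.

Lemma mse_left_le a r : (mse (rho s) S (left_part S a) <= (left_cost a r)%:E)%E.
Proof.
by rewrite -left_costE -(mseC _ _ (left_bip a)); exact: mse_le (left_bip a).
Qed.

(** With p and q the masses and z the difference of the means, the balance
p c_A + q c_B = 0 and p + q = 1 give c_A = q z and c_B = - p z. *)
Lemma means_on_line A B : bipartition A B ->
  exists u a r, [/\ dot u u = 1, 0 <= r, is_mean s A ((a + r / 2) *: u) &
                    is_mean s B ((a - r / 2) *: u)].
Proof.
move=> AB; have [mA mB _ _] := AB.
have [cA hA] := exists_mean s A mA (bip_subl _ _ AB).
have [cB hB] := exists_mean s B mB (bip_subr _ _ AB).
pose z := cA - cB; set p := mass s A in hA; set q := mass s B in hB.
have pq : p + q = 1 by exact: bip_mass.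
have bal : p *: cA + q *: cB = 0.
  apply/eqP; rewrite -dot_eq0; set w := _ + _.
  rewrite {1}/w dotDl !dotZl -hA -hB (bip_Rintegral _ _ _ AB (cts_dot w)).
  by rewrite (Rintegral_rho_dot _ sP).
have cAE : cA = q *: z.
  move/eqP: bal; rewrite addr_eq0 => /eqP pcA.
  by rewrite /z scalerBr -pcA -scalerDl addrC pq scale1r.
have cBE : cB = - p *: z.
  rewrite -[LHS](subKr cA) -/z {1}cAE -{2}[z]scale1r -scalerBl -pq.
  by congr (_ *: _); lra.
have [u [r [uu r0 zE]]] : exists u r, [/\ dot u u = 1, 0 <= r & z = r *: u].
  have [->|z0] := eqVneq z 0.
    by exists e1, 0; rewrite scale0r dot_e1e1.
  have zz : 0 < dot z z by rewrite lt0r dot_ge0 dot_eq0 z0.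
  have r0 : 0 < Num.sqrt (dot z z) by rewrite sqrtr_gt0.
  exists ((Num.sqrt (dot z z))^-1 *: z), (Num.sqrt (dot z z)).
  rewrite dotZl dotZr scalerA divff ?gt_eqF// scale1r ltW//; split=> //.
  rewrite mulrA -invfM -expr2 sqr_sqrtr ?ltW// mulVf// gt_eqF//.
exists u, ((q - p) * r / 2), r; split=> //.
  rewrite (_ : _ *: u = cA)//  cAE zE scalerA; congr (_ *: _).
  have -> : q = (1 + q - p) / 2 by lra.
  by rewrite (_ : p = 1 - q); last lra; field.
rewrite (_ : _ *: u = cB)//  cBE zE scalerA; congr (_ *: _).
by rewrite (_ : p = 1 - q); last lra; field.
Qed.

End two_means.

(** * Rotation to the axis and minimal bipartitions *)

Section minimal_bipartitions.
Context {R : realType} {n : nat}.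
Local Notation V := 'rV[R]_n.+1.
Variable s : probability V R.
Hypothesis sP : is_sphere_measure s.
Implicit Types (A B : set V) (c u v : V) (a r : R).
Local Notation S := (rho_support : set V).
Local Notation P A f := (\int[rho s]_(x in A) f x).
Local Notation M := (P S (fun x => dot x x)).

Lemma excess_le_spread A B u a : bipartition A B -> dot u u = 1 ->
  P A (fun x => dot x u - a) - P B (fun x => dot x u - a)
    <= spread s a `|dot u e1|.
Proof.
by move=> AB uu; rewrite -(Rintegral_rho_absdot _ sP)//; exact: bip_excess_le.
Qed.

Lemma mse_collinear A B u a r : bipartition A B -> dot u u = 1 ->
  is_mean s A ((a + r / 2) *: u) -> is_mean s B ((a - r / 2) *: u) ->
  mse (rho s) S A = (M + a ^+ 2 + r ^+ 2 / 4
    - r * (P A (fun x => dot x u - a) - P B (fun x => dot x u - a)))%:E.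
Proof.
by move=> AB uu mA mB; rewrite (mse_means _ _ _ _ _ AB mA mB) (cost_sum _ sP).
Qed.

Lemma exists_better_left A B : bipartition A B ->
  exists a, (mse (rho s) S (left_part S a) <= mse (rho s) S A)%E.
Proof.
move=> AB; have [u [a [r [uu r0 mA mB]]]] := means_on_line _ sP _ _ AB.
exists a; apply: le_trans (mse_left_le _ sP a r) _.
rewrite (mse_collinear _ _ _ _ _ AB uu mA mB) lee_fin /left_cost lerD2l lerN2.
apply: ler_wpM2l => //; apply: le_trans (excess_le_spread _ _ _ a AB uu) _.
by apply: le_spread; exact: norm_dot_unit_le1.
Qed.

Definition minimal A := forall B, measurable B -> B `<=` S ->
  (mse (rho s) S A <= mse (rho s) S B)%E.

Lemma minimal_mse_le A a r : minimal A ->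
  (mse (rho s) S A <= (left_cost s a r)%:E)%E.
Proof.
move=> minA; apply: le_trans (mse_left_le _ sP a r).
by apply: minA; [exact: measurable_left|move=> x []].
Qed.

(** The cut at 0 with centres e_1 and - e_1 costs M + 1 - 2 spread 0 1, which is
at most M - 1. *)
Lemma minimal_gap A B u a r : bipartition A B -> minimal A ->
  dot u u = 1 -> 0 <= r ->
  is_mean s A ((a + r / 2) *: u) -> is_mean s B ((a - r / 2) *: u) ->
  a ^+ 2 + r ^+ 2 / 4 + 1 <= r * spread s a `|dot u e1|.
Proof.
move=> AB minA uu r0 mA mB.
have := minimal_mse_le _ 0 2 minA.
rewrite (mse_collinear _ _ _ _ _ AB uu mA mB) lee_fin /left_cost.
have := ler_wpM2l r0 (excess_le_spread _ _ _ a AB uu).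
have := spread_ge _ sP 0 1; lra.
Qed.

Lemma minimal_r_gt0 A B u a r : bipartition A B -> minimal A ->
  dot u u = 1 -> 0 <= r ->
  is_mean s A ((a + r / 2) *: u) -> is_mean s B ((a - r / 2) *: u) ->
  0 < r.
Proof.
move=> AB minA uu r0 mA mB; rewrite lt_neqAle r0 andbT; apply/eqP => r00.
have := minimal_gap _ _ _ _ _ AB minA uu r0 mA mB.
rewrite -r00; have := sqr_ge0 a; nra.
Qed.

(** If |u_1| < 1 the dimension is at least two, and equality along the rotation
from u to e_1 collapses the spread to the average of |y_1 - a|, which is too
small for [minimal_gap]. *)
Lemma minimal_direction A B u a r : bipartition A B -> minimal A ->
  dot u u = 1 -> 0 <= r ->
  is_mean s A ((a + r / 2) *: u) -> is_mean s B ((a - r / 2) *: u) ->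
  `|dot u e1| = 1.
Proof.
move=> AB minA uu r0 mA mB.
have rgt0 := minimal_r_gt0 _ _ _ _ _ AB minA uu r0 mA mB.
have gap := minimal_gap _ _ _ _ _ AB minA uu r0 mA mB.
apply/eqP; rewrite eq_le norm_dot_unit_le1//= leNgt; apply/negP => t1.
have n0 : (0 < n)%N.
  rewrite lt0n; apply/eqP => n0; have : `|dot u e1| = 1; last by lra.
  apply/eqP; rewrite -(@eqrXn2 _ 2)// expr1n real_normK ?num_real//.
  rewrite -uu dot_e1 dotE (bigD1 ord0)//= big1 ?addr0 ?expr2// => i.
  rewrite -val_eqE /= => i0; have := ltn_ord i; rewrite ltnS => /leq_trans.
  by move=> /(_ _ (eq_leq n0)); rewrite leqn0 (negbTE i0).
have eqsp : spread s a 1 <= spread s a `|dot u e1|.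
  have := minimal_mse_le _ a r minA.
  rewrite (mse_collinear _ _ _ _ _ AB uu mA mB) lee_fin /left_cost lerD2l lerN2.
  rewrite ler_pM2l// => le1; apply: le_trans le1 _.
  exact: excess_le_spread AB uu.
have t01 : 0 <= `|dot u e1| < 1 by rewrite normr_ge0.
have := spread_collapse _ _ _ t01 eqsp.
have := le_spread s a _ _ (ltW t1).
have := absdot_le_quadratic _ sP a _ r0 n0.
move: gap; set L := Rintegral _ _ _ => gap q s1 s2.
have : r * spread s a `|dot u e1| <= r * L.
  by rewrite ler_wpM2l// (le_trans s1).
lra.
Qed.

(** Otherwise the parallel axis theorem would make the half-space cut, charged
at its own means, strictly cheaper than A. *)
Lemma left_means_of_minimal A a r : minimal A ->
  mse (rho s) S A = (left_cost s a r)%:E ->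
  is_mean s (S `\` left_part S a) ((a + r / 2) *: e1).
Proof.
move=> minA mseA; have LB := @left_bip R n a; have [mD mL _ _] := LB.
have [c cP] := exists_mean s _ mD (bip_subl _ _ LB).
have [d dP] := exists_mean s _ mL (bip_subr _ _ LB).
have := minA _ mD (bip_subl _ _ LB).
rewrite mseA (mse_means _ _ _ _ _ LB cP dP) lee_fin -(left_costE _ sP).
rewrite (cost_mean _ _ _ _ mD (bip_subl _ _ LB) cP).
rewrite (cost_mean _ _ _ _ mL (bip_subr _ _ LB) dP).
set w := _ - c; set w' := _ - d => le.
have : mass s (S `\` left_part S a) * dot w w = 0.
  apply/eqP; rewrite eq_le mulr_ge0 ?mass_ge0 ?dot_ge0// andbT.
  have : 0 <= mass s (left_part S a) * dot w' w'.
    by rewrite mulr_ge0 ?mass_ge0 ?dot_ge0.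
  lra.
move/eqP; rewrite mulf_eq0 => /orP[/eqP m0 v|].
  by rewrite cP m0 !mul0r.
by rewrite dot_eq0 subr_eq0 => /eqP ->.
Qed.

(** Equality in [excess_le_spread] makes the part of B beyond the hyperplane
x_1 = a null, but says nothing on the hyperplane.  The pieces A and
T2 = {x_1 > a} share the mean (a + r/2) e_1 and have the same integral of
x_1 - a, hence the same mass; as T2 lies in A up to a null set, they agree. *)
Lemma minimal_left A B a r : bipartition A B -> minimal A -> 0 < r ->
  is_mean s A ((a + r / 2) *: e1) -> is_mean s B ((a - r / 2) *: e1) ->
  rho s (left_part S a `+` B) = 0%E.
Proof.
move=> AB minA r0 mA mB.
pose T1 := left_part S a; pose T2 := S `\` T1; rewrite -/T1.
have LB : bipartition T2 T1 := left_bip a.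
have [measA measB U AI] := AB; have [mT2 mT1 _ _] := LB.
have AS := bip_subl _ _ AB; have BS := bip_subr _ _ AB.
have T2S := bip_subl _ _ LB.
pose l (x : V) := dot x e1 - a; have cl : continuous l := cts_lin e1 a.
pose al (x : V) := `|l x|; have cal : continuous al := cts_absdot e1 a.
have mseA := mse_collinear _ _ _ _ _ AB dot_e1e1 mA mB.
have exc : P A l - P B l = spread s a 1.
  apply/eqP; rewrite eq_le; apply/andP; split.
    by have := excess_le_spread _ _ _ a AB dot_e1e1; rewrite dot_e1e1 normr1.
  have := minimal_mse_le _ a r minA.
  by rewrite mseA lee_fin /left_cost lerD2l lerN2 ler_pM2l.
have T2mean : is_mean s T2 ((a + r / 2) *: e1).
  by apply: (left_means_of_minimal A) => //; rewrite mseA exc.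
have abs_tot : P S al = spread s a 1.
  by rewrite (Rintegral_rho_absdot _ sP) ?dot_e1e1 ?normr1.
have lT2 : P T2 l = (spread s a 1 + P S l) / 2.
  have [] := left_abs s a; rewrite -/T2 -/T1 -/l -/al => E1 E2.
  have := bip_Rintegral s _ _ _ LB cl; have := bip_Rintegral s _ _ _ LB cal.
  rewrite -/l -/al; lra.
have lA : P A l = (spread s a 1 + P S l) / 2.
  by have := bip_Rintegral s _ _ _ AB cl; lra.
have mean_l D : measurable D -> D `<=` S ->
    is_mean s D ((a + r / 2) *: e1) -> P D l = mass s D * (r / 2).
  by move=> mD DS Dm; rewrite Rintegral_lin// Dm dotZl dot_e1e1; ring.
have massAT2 : mass s A = mass s T2.
  have r2 : r / 2 != 0 by rewrite gt_eqF// divr_gt0.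
  apply: (mulIf r2).
  by rewrite -(mean_l A)// -(mean_l T2)// lA lT2.
have PB : P B (fun x => al x + l x) = 0.
  rewrite RintegralD_rho//.
  have := bip_Rintegral s _ _ _ AB cal; have := bip_Rintegral s _ _ _ AB cl.
  have : P A l <= P A al.
    by apply: le_Rintegral_rho => // x; exact: ler_norm.
  have : - P B l <= P B al.
    rewrite -mulN1r -RintegralZ_rho//; apply: le_Rintegral_rho => //.
      by apply: cts_mul => //; exact: cts_cst.
    by move=> x; rewrite mulN1r /al -normrN ler_norm.
  lra.
have mass_cut C D E : bipartition C D -> measurable E -> E `<=` S ->
    mass s E = mass s (E `&` C) + mass s (E `&` D).
  move=> [mC mD CDU CDI] mE ES; rewrite -massU//; try exact: measurableI.
    by rewrite -setIUr CDU setIidl.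
  by rewrite setIACA CDI setI0.
have BT2 : mass s (B `&` T2) = 0.
  have alpos x : 0 <= al x + l x.
    by have := ler_norm (- l x); rewrite normrN /al; lra.
  rewrite -(mass_pos_integral0 s B _ measB BS (cts_add _ _ cal cl) alpos PB).
  congr (mass s _); apply/seteqP; split=> x [Bx].
    move=> [_ /not_andP[|/negP]]; first by move/(_ (BS _ Bx)).
    rewrite -ltNge -dot_e1 -subr_gt0 => lx; split=> //=.
    by rewrite addr_gt0// normr_gt0 gt_eqF.
  move=> /= lx; split=> //; split; first exact: BS.
  move=> [_]; rewrite -dot_e1 -subr_le0 => l0.
  by move: lx; rewrite /al /l ler0_norm// addNr ltxx.
have AT1 : mass s (A `&` T1) = 0.
  have := mass_cut _ _ A LB measA AS.
  have := mass_cut _ _ T2 AB mT2 T2S.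
  rewrite (setIC T2 A) (setIC T2 B) BT2 massAT2; lra.
have -> : T1 `+` B = (A `&` T1) `|` (B `&` T2).
  apply/seteqP; split=> x.
    case=> -[xT nx]; [left|right]; split=> //.
      have [Sx _] := xT; by have : (A `|` B) x by [rewrite U]; case.
    by split=> //; exact: BS.
  case=> -[xA [xS xT]]; [left|right]; split=> //.
  by move=> Bx; rewrite -[False]/(set0 x) -AI.
rewrite rhoE_mass; last by apply: measurableU; exact: measurableI.
rewrite massU ?AT1 ?BT2 ?addr0//; [exact: measurableI..|].
by rewrite setIACA AI set0I.
Qed.

Lemma mse_minimalC A B : bipartition A B -> minimal A -> minimal B.
Proof. by move=> AB minA; rewrite /minimal -(mseC s _ _ AB). Qed.

Lemma minimal_is_left A B : bipartition A B -> minimal A ->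
  exists a, rho s (left_part S a `+` A) = 0%E \/
            rho s (left_part S a `+` B) = 0%E.
Proof.
move=> AB minA; have [u [a [r [uu r0 mA mB]]]] := means_on_line _ sP _ _ AB.
have rgt0 := minimal_r_gt0 _ _ _ _ _ AB minA uu r0 mA mB.
have := minimal_direction _ _ _ _ _ AB minA uu r0 mA mB.
have [t0|t0] := leP 0 (dot u e1).
  rewrite ger0_norm// => /(dot_unit_eq1 _ uu) ue; rewrite {}ue in mA mB.
  by exists a; right; exact: (minimal_left _ _ _ _ AB minA rgt0 mA mB).
(* for u = - e_1 the pieces swap roles and the cutoff is - a *)
rewrite ltr0_norm// -dotNl => ue; have uu' : dot (- u) (- u) = 1.
  by rewrite dotNl dotNr opprK.
have {}ue := dot_unit_eq1 _ uu' ue.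
have E k : k *: u = (- k) *: e1 by rewrite -ue scaleNr scalerN opprK.
exists (- a); left.
apply: (minimal_left _ _ _ _ (bipartitionC _ _ AB) _ rgt0).
- exact: mse_minimalC AB minA.
- by rewrite (_ : - a + r / 2 = - (a - r / 2)) -?E//; ring.
- by rewrite (_ : - a - r / 2 = - (a + r / 2)) -?E//; ring.
Qed.

End minimal_bipartitions.

Theorem theorem2p2 (R : realType) (n : nat)
    (sigma0 : probability 'rV[R]_n.+1 R)
    (sigma0P : is_sphere_measure sigma0)
    (S1 S2 : set 'rV[R]_n.+1)
    (mS1 : measurable S1) (mS2 : measurable S2)
    (S12U : S1 `|` S2 = rho_support) (S12I : S1 `&` S2 = set0) :
  (exists a : R,
     (mse (rho sigma0) rho_support (left_part rho_support a)
        <= mse (rho sigma0) rho_support S1)%E) /\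
  ((forall B : set 'rV[R]_n.+1, measurable B -> B `<=` rho_support ->
      (mse (rho sigma0) rho_support S1 <= mse (rho sigma0) rho_support B)%E) ->
   exists a : R,
     rho sigma0 (left_part rho_support a `+` S1) = 0%E \/
     rho sigma0 (left_part rho_support a `+` S2) = 0%E).
Proof.
have S12 : bipartition S1 S2 by split.
split; first exact: exists_better_left sigma0P _ _ S12.
by move=> minS1; exact: minimal_is_left sigma0P _ _ S12 minS1.
Qed.
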